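(* Let $n\ge 1$ be an integer. Let $X$ be a random variable with distribution function $F_X(x)=1-\exp\left(-\frac{x}{2}\right)$, $x>0$, and let $X_{(1)}\le X_{(2)}\le\cdots\le X_{(n)}$ denote the order statistics based on a random sample $X_1,\dots,X_n$ (i.i.d.) from $X$. Let $K^*$ be the Hollander–Proschan statistic computed from this sample, and let $e_{i,n}=\frac{n+2-2i}{2n}$ for $i=1,\dots,n$, where for the fixed $n$ it is assumed that $e_{i,n}\neq e_{k,n}$ for all $i\neq k$. Then for every real $x$, $$P\left(K^*\le x\right)=1-\sum_{i=1}^{n}\ \prod_{\substack{k=1\\ k\neq i}}^{n}\left(\frac{e_{i,n}-x}{e_{i,n}-e_{k,n}}\right) I\left(x,e_{i,n}\right),$$ where $I(x,y)=1$ if $x<y$ and $I(x,y)=0$ if $x\ge y$.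
   Context: For a sample $X_1,\dots,X_n$ with order statistics $X_{(1)}\le\cdots\le X_{(n)}$ and sample mean $\bar X_n=\frac1n\sum_{i=1}^n X_i$, define $$K=\frac{1}{n^2}\sum_{k=1}^n X_{(k)}\left\{\frac{3n}{2}-2k+1\right\},\qquad K^*=\frac{K}{\bar X_n}.$$ The empty product is $1$. *)

(* Defs.v *)
From HB Require Import structures.
From mathcomp Require Import all_boot all_order all_algebra.
From mathcomp Require Import all_classical all_reals all_analysis.
Set Implicit Arguments.
Unset Strict Implicit.
Unset Printing Implicit Defensive.
Import Order.TTheory GRing.Theory Num.Theory.
Import numFieldNormedType.Exports.
Local Open Scope classical_set_scope.
Local Open Scope ring_scope.

Definition mutually_independent (d : measure_display) (T : measurableType d)
    (R : realType) (P : probability T R) (I : finType)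
    (X : I -> {RV P >-> R}) : Prop :=
  forall (J : {set I}) (A : I -> set R), (forall i, measurable (A i)) ->
    P (\bigcap_(i in [set j | j \in J]) (X i @^-1` A i)) =
    (\prod_(i in J) P (X i @^-1` A i))%E.

(* [d0], [T0] and [Q] carry the population variable [X0]; the sample [X] may
   live on another probability space. *)
Definition random_sample (d d0 : measure_display)
    (T : measurableType d) (T0 : measurableType d0) (R : realType)
    (P : probability T R) (Q : probability T0 R) (n : nat)
    (X : 'I_n -> {RV P >-> R}) (X0 : {RV Q >-> R}) : Prop :=
  mutually_independent X /\
  forall (i : 'I_n) (A : set R), measurable A ->
    distribution P (X i) A = distribution Q X0 A.

Section statistics.
Variables (R : realType) (n : nat).
Implicit Type x : 'I_n -> R.

(* The rank [k] is counted from 1, hence the predecessor; the default 0 of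
   [nth] is not reached for 1 <= k <= n. *)
Definition order_stat x (k : nat) : R :=
  nth 0 (sort <=%R [seq x i | i <- enum 'I_n]) k.-1.

Definition sample_mean x : R := n%:R^-1 * \sum_(i < n) x i.

Definition HP_K x : R :=
  (n%:R ^+ 2)^-1 *
  \sum_(1 <= k < n.+1) order_stat x k * (3 * n%:R / 2 - 2 * k%:R + 1).

(* Division by a zero mean yields 0; for exponential samples of size n >= 1
   this happens with probability 0. *)
Definition HP_Kstar x : R := HP_K x / sample_mean x.

End statistics.

(* Written in R, not in nat: the numerator is negative for large [i]. *)
Definition e_coef (R : realType) (n i : nat) : R :=
  (n%:R + 2 - 2 * i%:R) / (2 * n%:R).

Definition I_lt (R : realType) (x y : R) : R := if x < y then 1 else 0.

(* Main.v *)
Require Import Defs.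
From HB Require Import structures.
From mathcomp Require Import all_boot all_order all_algebra.
From mathcomp Require Import fingroup perm.
From mathcomp Require Import all_classical all_reals all_analysis.
From mathcomp Require Import measurable_realfun.
From mathcomp Require Import ring lra.
Set Implicit Arguments.
Unset Strict Implicit.
Unset Printing Implicit Defensive.
Import Order.TTheory GRing.Theory Num.Theory.
Import numFieldNormedType.Exports.
Local Open Scope classical_set_scope.
Local Open Scope ring_scope.

(** Write the order statistics of the sample through the normalized gaps
    D_j = (n - j + 1) (X_(j) - X_(j-1)), with X_(0) = 0.  Summation by parts
    turns the numerator K into the sum of the e_(j,n) D_j divided by n, and the
    mean into the sum of the D_j divided by n, so that K* > x means that the sum
    of the (e_(j,n) - x) D_j is positive ([gap_coefs_K_weight],
    [K_star_sorted_le]).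

    For exponential variables the gaps D_j are again independent with the same
    exponential law.  This is obtained by integrating out the sample in
    increasing order: on the event that the sample is strictly increasing, the
    smallest entry is removed and the remaining ones form a sample of the same
    kind above it ([integral_exponential_gap], [probability_increasing_pos]).
    Each of the n! orderings contributes the same amount, because a permuted
    sample is again a sample, and together they have probability 1, so ties do
    not matter ([probability_HP_Kstar_gt]).

    It remains to find the probability p(c_1, ..., c_n) that c_1 D_1 + ... +
    c_n D_n > 0, for distinct c_i.  Given the sum u of two exponential
    variables, the first one is uniform on [0, u]; comparing lengths of
    intervals then gives, for every starting value s added to the linear
    combination,
      (a - b) p(c, a, b) = a p(c, a) - b p(c, b)
    where c stands for the remaining coefficients ([pos_prob2], [pos_prob_cat2]).  The divided difference of the function
    c^(n-1) 1_(c > 0) at the points c_i satisfies the same recursion and agrees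
    with p for n = 1.  Written out, this divided difference is the sum of the
    theorem ([pos_prob_formula]). *)

(** * The exponential law *)

Import HBNNSimple.

Section exponential_law.
Context {R : realType}.
Notation mu := (@lebesgue_measure R).

(** The half-lines ]-oo, x] form a pi-system that generates the Borel sets.
    For x <= 0, where the hypothesis is silent, monotonicity forces the value 0,
    because 1 - expR (- (r * y)) tends to 0 when y decreases to 0. *)
Lemma cdf_exponential_law (r : R) (eps : probability R R) : 0 < r ->
  (forall x, 0 < x -> eps `]-oo, x]%classic = (1 - expR (- (r * x)))%:E) ->
  forall A, measurable A -> eps A = exponential_prob r A.
Proof.
move=> r0 cdfE.
pose ex := exponential_distribution_exponential_prob__canonical__probability_measure_Probability r0.
have exC x : 0 < x -> ex `]-oo, x]%classic = (1 - expR (- (r * x)))%:E.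
  move=> x0; rewrite -mulNr EFinB -(exponential_prob_itv0c r x0) /= /exponential_prob.
  rewrite [LHS]integral_mkcond [RHS]integral_mkcond; apply: eq_integral => y _.
  rewrite !patchE !mem_setE !in_itv /=.
  case: (leP y x) => yx; rewrite ?andbT ?andbF //.
  by case: leP => // y0; rewrite lt0_exponential_pdf.
have conv (p : set R -> \bar R) : (forall A, 0 <= p A)%E ->
    (forall A B, measurable A -> measurable B -> A `<=` B -> p A <= p B)%E ->
    (forall x, 0 < x -> p `]-oo, x]%classic = (1 - expR (- (r * x)))%:E) ->
    forall x, p `]-oo, x]%classic = ((1 - expR (- (r * x)))%:E * (0 < x)%R%:R%:E)%E.
  move=> p0 le_p pE x.
  have [x0|x0] := ltP 0 x; first by rewrite mule1 pE.
  rewrite mule0; apply/eqP; rewrite eq_le p0 andbT.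
  apply/lee_addgt0Pr => e e0; rewrite add0e.
  have ey : 0 < e / r by rewrite divr_gt0.
  apply: (@le_trans _ _ (p `]-oo, e / r]%classic)).
    by apply: le_p => //; apply: subset_itvl; rewrite bnd_simp (le_trans x0)// ltW.
  rewrite pE // lee_fin mulrCA divff ?gt_eqF // mulr1.
  by have := expR_ge1Dx (- e); lra.
move=> A mA; change (eps A = ex A).
(* The two types of real numbers have the same Borel sets but different
   displays; the image of eps under the identity lives on the second one. *)
have mid : measurable_fun setT (idfun : R -> measurableTypeR R).
  exact: (@measurable_id _ R setT).
pose eps' : {measure set (measurableTypeR R) -> \bar R} :=
  pushforward eps (idfun : R -> measurableTypeR R).
pose G : set (set R) := [set B | exists x, B = `]-oo, x]%classic].
refine (@measure_unique _ R (measurableTypeR R) G (fun n => `]-oo, n%:R]%classic)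
  _ _ _ _ (eps' mid) ex _ _ A mA) => //.
- have GE x : <<s G >> `]-oo, x]%classic by apply: sub_sigma_algebra; exists x.
  apply/seteqP; split => B.
    apply: smallest_sub; first exact: smallest_sigma_algebra.
    move=> _ [[a b] _ <-] /=.
    have -> : `]a, b]%classic = `]-oo, b]%classic `\` `]-oo, a]%classic.
      by rewrite -[RHS]setCK setCD setCitvl setUC -[LHS]setCK setCitv.
    exact: (@measurableD _ (g_sigma_algebraType G) _ _ (GE b) (GE a)).
  apply: smallest_sub; first exact: (@sigma_algebra_measurable _ (measurableTypeR R)).
  by move=> _ [x ->]; exact: measurable_itv.
- move=> _ _ [x ->] [y ->]; exists (Num.min x y).
  by apply/seteqP; split => z /=; rewrite !in_itv /= le_min => /andP.
- by move=> n; exists n%:R.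
- apply/seteqP; split => // x _; exists (Num.bound `|x|) => //=.
  by rewrite in_itv /= (le_trans (ler_norm _)) // ltW // archi_boundP.
- move=> _ [x ->]; transitivity (eps `]-oo, x]%classic) => //.
  rewrite (conv eps) //; last by move=> B C mB mC BC; apply: le_measure; rewrite ?inE.
  apply/esym; apply: (conv ex) => //.
  by move=> B C mB mC BC; apply: le_measure; rewrite ?inE.
- move=> k; apply: (@le_lt_trans _ _ 1%E); last exact: ltry.
  exact: (@probability_le1 _ R R eps `]-oo, k%:R]%classic).
Qed.

(** Indicators satisfy the identity because the law has this density; linearity
    extends it to simple functions and monotone convergence to the rest. *)
Lemma ge0_integral_exponential_law (r : R) (eps : probability (measurableTypeR R) R)
    (g : measurableTypeR R -> \bar R) :
  0 < r -> (forall A, measurable A -> eps A = exponential_prob r A) ->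
  measurable_fun setT g -> (forall x, 0 <= g x)%E ->
  (\int[eps]_x g x = \int[mu]_x (g x * (exponential_pdf r x)%:E))%E.
Proof.
move=> r0 epsE mg g0.
have pdf0 x : 0 <= exponential_pdf r x by apply: exponential_pdf_ge0; exact: ltW.
have mpdf : measurable_fun setT (fun x => (exponential_pdf r x)%:E).
  by apply/measurable_EFinP; exact: measurable_exponential_pdf.
pose g_ := nnsfun_approx measurableT mg.
transitivity (lim (\int[eps]_x (g_ n x)%:E @[n --> \oo])%E).
  rewrite -monotone_convergence//=.
  - apply: eq_integral => ? /[!inE] xD; apply/esym/cvg_lim => //=.
    exact: cvg_nnsfun_approx.
  - by move=> n; exact/measurable_EFinP/measurable_funTS.
  - by move=> n ? _; rewrite lee_fin.
  - by move=> ? _ ? ? mn; rewrite lee_fin; exact/lefP/nd_nnsfun_approx.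
transitivity (lim (\int[mu]_x ((g_ n x)%:E * (exponential_pdf r x)%:E) @[n --> \oo])%E); last first.
  rewrite -monotone_convergence//=.
  - apply: eq_integral => x _; apply/cvg_lim => //=.
    by apply: cvgeZr => //; exact: cvg_nnsfun_approx.
  - by move=> n; apply: emeasurable_funM => //; exact/measurable_EFinP/measurable_funTS.
  - by move=> n x _; rewrite -EFinM lee_fin mulr_ge0.
  - move=> x _ m n mn; rewrite -!EFinM lee_fin ler_wpM2r //.
    exact/lefP/nd_nnsfun_approx.
apply: congr_lim; apply/funext => n /=.
under eq_integral do rewrite fimfunE -fsumEFin//.
rewrite [LHS]ge0_integral_fsum//; last 2 first.
  - by move=> t; exact/measurable_EFinP/measurableT_comp.
  - by move=> m x _; rewrite EFinM nnfun_muleindic_ge0.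
under [RHS]eq_integral.
  move=> x xD; rewrite fimfunE -fsumEFin// ge0_mule_fsuml; last first.
    by move=> t; rewrite EFinM nnfun_muleindic_ge0.
  over.
rewrite [RHS]ge0_integral_fsum//; last 2 first.
  - move=> t; apply: emeasurable_funM => //.
    by apply/measurable_EFinP; do 2 apply/measurableT_comp => //.
  - move=> m x _; apply: mule_ge0; last by rewrite lee_fin.
    by rewrite EFinM nnfun_muleindic_ge0.
apply: eq_fsbigr => t _.
rewrite integralZl_indic_nnsfun// integral_indic// setIT.
transitivity (t%:E * \int[mu]_(x in g_ n @^-1` [set t]) (exponential_pdf r x)%:E)%E.
  by congr (_ * _)%E; apply: epsE; exact: measurable_funPTI.
have [t0|t0] := ltP t 0.
  rewrite preimage_nnfun0 // integral_set0 mule0.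
  rewrite integral0_eq // => x _.
  by rewrite indicE memNset ?mulr0 ?mul0e // => -[].
rewrite -ge0_integralZl //; last 2 first.
- exact: measurable_funTS.
- by move=> x _; rewrite lee_fin.
rewrite [LHS]integral_mkcond.
apply: eq_integral => x _; rewrite patchE indicE; case: ifPn => _.
  by rewrite mulr1.
by rewrite mulr0 mul0e.
Qed.

End exponential_law.

(** * The gap below the smallest of several exponential variables *)

Lemma measurable_gt0 (R : realType) :
  measurable_fun [set: measurableTypeR R] (fun t : measurableTypeR R => (0 < t)%R%:R : R).
Proof.
rewrite (_ : (fun s => _) = \1_`]0, +oo[%classic); first exact: measurable_indic.
by apply/funext => x; rewrite indicE mem_setE /= in_itv /= andbT.
Qed.

Section affine.
Context {R : realType}.
Notation mu := (@lebesgue_measure R).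

(** The substitution is needed for integrands that are only measurable.  It
    amounts to the equality of Lebesgue measure with k times its image under
    the affine map, which is checked on bounded intervals. *)
Lemma ge0_integral_affine (u k : R) (f : measurableTypeR R -> \bar R) : 0 < k ->
  measurable_fun setT f -> (forall x, 0 <= f x)%E ->
  (\int[mu]_x f x = k%:E * \int[mu]_y f (u + k * y)%R)%E.
Proof.
move=> k0 mf f0.
pose phi (y : measurableTypeR R) : measurableTypeR R := u + k * y.
have mphi : measurable_fun setT phi.
  by apply: measurable_funD => //; exact: measurable_funM.
pose kn : {nonneg R} := NngNum (ltW k0).
pose nu : {measure set (measurableTypeR R) -> \bar R} :=
  mscale kn (measure_function_pushforward__canonical__measure_function_Measure mu mphi).
have nuE : forall A, measurable A -> mu A = nu A.
  apply: lebesgue_measure_unique => _ [[a b] _ <-] /=.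
  rewrite /mscale /= /pushforward.
  have -> : phi @^-1` `]a, b] = `](a - u) / k, (b - u) / k]%classic.
    apply/seteqP; split => y /=; rewrite !in_itv /= /phi ltr_pdivrMr // ler_pdivlMr //
      => /andP[h1 h2]; apply/andP; split; lra.
  rewrite !lebesgue_measure_itv /= !lte_fin ltr_pM2r ?invr_gt0 // ltrD2r.
  case: ifPn => ab; last by rewrite mule0.
  by rewrite -!EFinD -EFinM; congr EFin; field; rewrite gt_eqF.
rewrite (eq_measure_integral nu) => [|A mA _]; last exact: nuE.
rewrite ge0_integral_mscale //; congr (_ * _)%E.
by rewrite ge0_integral_pushforward.
Qed.

End affine.

Section exponential_gap.
Context {R : realType} (r : R) (eps : probability (measurableTypeR R) R).
Hypothesis r0 : 0 < r.
Hypothesis epsE : forall A, measurable A -> eps A = exponential_prob r A.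
Notation mu := (@lebesgue_measure R).

(** If x is the smallest of k + 1 independent exponential variables, then
    expR (- (r * k * x)) is the probability that the k others exceed x.  The
    substitution x = u + y / (k + 1) makes the density of x above u into the
    exponential density of y: conditionally on all variables exceeding u, the
    gap between u and their minimum, multiplied by k + 1, is exponential with
    the same rate.  The factor 1 / (k + 1) is the probability that a given
    variable is the smallest. *)
Lemma integral_exponential_gap (u : R) (k : nat) (G : measurableTypeR R -> \bar R) :
  0 <= u -> measurable_fun setT G -> (forall x, 0 <= G x)%E ->
  (\int[eps]_x (((u < x)%R%:R * expR (- (r * k%:R * x)))%:E * G x) =
   (expR (- (r * k.+1%:R * u)) / k.+1%:R)%:E *
     \int[eps]_y G (u + k.+1%:R^-1 * y)%R)%E.
Proof.
move=> u0 mG G0.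
have pdf0 x : 0 <= exponential_pdf r x by apply: exponential_pdf_ge0; exact: ltW.
have mpdf : measurable_fun [set: measurableTypeR R] (fun x => (exponential_pdf r x)%:E).
  by apply/measurable_EFinP; exact: measurable_exponential_pdf.
have mw : measurable_fun [set: measurableTypeR R]
    (fun x : measurableTypeR R => ((u < x)%R%:R * expR (- (r * k%:R * x)))%:E : \bar R).
  apply/measurable_EFinP; apply: measurable_funM; last first.
    by apply: measurableT_comp => //; apply: measurableT_comp => //; exact: measurable_funM.
  rewrite (_ : (fun x => _) = \1_`]u, +oo[%classic); last first.
    by apply/funext => x; rewrite indicE mem_setE /= in_itv /= andbT.
  exact: measurable_indic.
have w0 x : (0 <= ((u < x)%R%:R * expR (- (r * k%:R * x)))%:E :> \bar R)%E.
  by rewrite lee_fin mulr_ge0 ?expR_ge0 ?ler0n.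
have k0 : (0 : R) < k.+1%:R^-1 by rewrite invr_gt0 ltr0n.
have maff (f : measurableTypeR R -> \bar R) : measurable_fun setT f ->
    measurable_fun [set: measurableTypeR R] (fun y => f (u + k.+1%:R^-1 * y)).
  move=> mf; apply: measurableT_comp => //.
  by apply: measurable_funD => //; exact: measurable_funM.
rewrite (ge0_integral_exponential_law r0 epsE); last 2 first.
- exact: emeasurable_funM.
- by move=> x; rewrite mule_ge0.
rewrite (ge0_integral_exponential_law r0 epsE); last 2 first.
- exact: maff.
- by move=> x.
have mL : measurable_fun [set: measurableTypeR R] (fun x =>
    ((u < x)%R%:R * expR (- (r * k%:R * x)))%:E * G x * (exponential_pdf r x)%:E)%E.
  by do 2 apply: emeasurable_funM => //.
have L0 x : (0 <= ((u < x)%R%:R * expR (- (r * k%:R * x)))%:E * G x * (exponential_pdf r x)%:E)%E.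
  by rewrite !mule_ge0 // lee_fin.
rewrite (ge0_integral_affine u k0 mL L0).
rewrite [X in _ = (X%:E * _)%E]mulrC (EFinM k.+1%:R^-1) -[RHS]muleA; congr (_ * _)%E.
have mR : measurable_fun [set: measurableTypeR R]
    (fun y => G (u + k.+1%:R^-1 * y)%R * (exponential_pdf r y)%:E)%E.
  by apply: emeasurable_funM => //; exact: maff.
have R0 y : (0 <= G (u + k.+1%:R^-1 * y)%R * (exponential_pdf r y)%:E)%E.
  by rewrite mule_ge0 // lee_fin.
rewrite -ge0_integralZl ?lee_fin ?expR_ge0 //.
apply: ge0_ae_eq_integral => //.
- exact: (maff _ mL).
- exact: emeasurable_funM.
- by move=> y _; rewrite mule_ge0 // lee_fin expR_ge0.
(* At y = 0 the factor u < x vanishes on one side only, which is harmless since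
   a point is negligible. *)
exists [set 0]; split => //; first exact: lebesgue_measure_set1.
move=> y /=; apply: contra_notP => /eqP y0 _.
rewrite ltrDl pmulr_rgt0 //.
have [yneg|ypos|/esym /eqP] := ltgtP y 0; last by rewrite eq_sym (negbTE y0).
  by rewrite mul0r !mul0e lt0_exponential_pdf // !mule0.
rewrite mul1r !exponential_pdfE ?(ltW ypos) //; last first.
  by rewrite addr_ge0 // mulr_ge0 // ltW.
rewrite [LHS]muleAC [RHS]muleCA -EFinM [RHS]muleC -EFinM; congr (_ * _)%E; congr EFin.
rewrite mulrCA [RHS]mulrCA -!expRD; congr (_ * expR _).
by rewrite -natr1; field; rewrite natr1 pnatr_eq0.
Qed.

End exponential_gap.

(** * The sum of two exponential variables *)

Section length.
Context {R : realType}.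
Notation mu := (@lebesgue_measure R).

(** For 0 <= u, the length of the part of [0, u] on which t + c x is positive. *)
Definition halfline_length (t c u : R) : R :=
  if c == 0 then (0 < t)%R%:R * u
  else (Num.max (t + c * u) 0 - Num.max t 0) / c.

Lemma length_halfline (t c u : R) : 0 <= u ->
  mu [set x : R | 0 <= x <= u /\ 0 < t + c * x] = (halfline_length t c u)%:E.
Proof.
move=> u0; rewrite /halfline_length; have [->|c0] := eqVneq c 0.
  have [t0|t0] := ltP 0 t.
    rewrite mul1r (_ : [set x | _] = `[0, u]%classic); last first.
      by apply/seteqP; split => x /=; rewrite in_itv /= mul0r addr0; [case|].
    rewrite lebesgue_measure_itv /= lte_fin.
    by case: ltP => // u0'; rewrite ?sube0 //; congr EFin; lra.
  rewrite mul0r (_ : [set x | _] = set0) ?measure0 //.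
  apply/seteqP; split => x //=; rewrite mul0r addr0 => -[_]; lra.
have [cneg|cpos] := ltP c 0.
  have [t0|t0] := leP t 0.
    rewrite (_ : [set x | _] = set0) ?measure0; last first.
      apply/seteqP; split => x //= [/andP[x0 _]]; nra.
    by congr EFin; rewrite !max_r ?subrr ?mul0r //; nra.
  have tc0 : 0 < - t / c by rewrite mulNr -mulrN -invrN divr_gt0 // oppr_gt0.
  have eqx x : (0 < t + c * x) = (x < - t / c).
    by rewrite ltr_ndivlMr //; apply/idP/idP => ?; lra.
  have [tu|tu] := ltP 0 (t + c * u).
    rewrite (_ : [set x | _] = `[0, u]%classic); last first.
      apply/seteqP; split => x /=; rewrite in_itv /=; first by case.
      by move=> /andP[x0 xu]; rewrite x0 xu; split => //; nra.
    rewrite lebesgue_measure_itv /= lte_fin.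
    case: ltP => // u0'; rewrite ?sube0 //; congr EFin; first by field; rewrite c0.
    by rewrite (_ : u = 0) ?mulr0 ?addr0 ?subrr ?mul0r //; lra.
  rewrite (_ : [set x | _] = `[0, - t / c[%classic); last first.
    apply/seteqP; split => x /=; rewrite in_itv /= eqx; first by case=> /andP[-> _] ->.
    move=> /andP[x0 xt]; rewrite x0; split => //=; rewrite (le_trans (ltW xt)) //.
    by rewrite ler_ndivrMr // mulrC; lra.
  rewrite lebesgue_measure_itv /= lte_fin tc0 sube0.
  by rewrite sub0r.
have {c0}cpos : 0 < c by rewrite lt_neqAle eq_sym c0.
have eqx x : (0 < t + c * x) = (- t / c < x).
  by rewrite ltr_pdivrMr //; apply/idP/idP => ?; lra.
have [t0|t0] := ltP 0 t.
  rewrite (_ : [set x | _] = `[0, u]%classic); last first.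
    apply/seteqP; split => x /=; rewrite in_itv /=; first by case.
    by move=> /andP[x0 xu]; rewrite x0 xu; split => //; nra.
  rewrite lebesgue_measure_itv /= lte_fin max_l; last by nra.
  case: ltP => // u0'; rewrite ?sube0 //; congr EFin; first by field; rewrite gt_eqF.
  by rewrite (_ : u = 0) ?mulr0 ?addr0 ?subrr ?mul0r //; lra.
have tc0 : 0 <= - t / c by rewrite divr_ge0 ?oppr_ge0 // ltW.
rewrite (_ : [set x | _] = `]- t / c, u]%classic); last first.
  apply/seteqP; split => x /=; rewrite in_itv /= eqx; first by case=> /andP[_ ->] ->.
  by move=> /andP[xt ->]; rewrite xt andbT (le_trans tc0 (ltW xt)).
rewrite lebesgue_measure_itv /= lte_fin -eqx subr0.
case: ltP => tu; last by rewrite mul0r.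
by rewrite -EFinD; congr EFin; field; rewrite gt_eqF.
Qed.

End length.

Section convolution.
Context {R : realType} (r : R) (eps : probability (measurableTypeR R) R).
Hypothesis r0 : 0 < r.
Hypothesis epsE : forall A, measurable A -> eps A = exponential_prob r A.
Notation mu := (@lebesgue_measure R).
Local Notation mR := (measurableTypeR R).

(** In the coordinates (x, u) with u = x + y, the joint density of two
    independent exponential variables is r^2 expR (- (r * u)) on 0 <= x <= u.
    It does not depend on x: given the sum u, the first variable is uniform on
    [0, u]. *)
Lemma integral_exponential_convolution (g : mR * mR -> \bar R) :
  measurable_fun setT g -> (forall z, 0 <= g z)%E ->
  (\int[eps]_x \int[eps]_y g (x, (x + y)%R) =
   \int[mu]_u ((r * exponential_pdf r u)%:E *
      \int[mu]_(x in `[0%R, u]) g (x, u)))%E.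
Proof.
move=> mg g0.
have pdf0 x : 0 <= exponential_pdf r x by apply: exponential_pdf_ge0; exact: ltW.
have mpdf : measurable_fun [set: mR] (fun x => (exponential_pdf r x)%:E).
  by apply/measurable_EFinP; exact: measurable_exponential_pdf.
have msub : measurable_fun [set: mR * mR] (fun z => (exponential_pdf r (z.2 - z.1))%:E).
  apply/measurable_EFinP; apply: measurableT_comp; first exact: measurable_exponential_pdf.
  by apply: measurable_funB.
have mpair x : measurable_fun [set: mR] (fun u : mR => (x, u) : mR * mR) by exact: measurable_fun_pair.
have gE x : (\int[eps]_y g (x, (x + y)%R) =
    \int[mu]_u (g (x, u) * (exponential_pdf r (u - x))%:E))%E.
  have madd : measurable_fun [set: mR] (fun y : mR => x + y : mR) by exact: measurable_funD.
  have mgx : measurable_fun [set: mR] (fun y : mR => g (x, x + y)).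
    exact: (measurableT_comp mg (measurableT_comp (mpair x) madd)).
  rewrite (ge0_integral_exponential_law r0 epsE mgx (fun y => g0 _)).
  (* The substitution u = x + y. *)
  rewrite [RHS](@ge0_integral_affine _ x 1) //; last 2 first.
    - apply: emeasurable_funM.
        exact: (measurableT_comp mg (mpair x)).
      exact: (measurableT_comp msub (mpair x)).
    - by move=> u; rewrite mule_ge0 // lee_fin.
  rewrite mul1e; apply: eq_integral => y _.
  by rewrite mul1r addrAC subrr add0r.
under eq_integral do rewrite gE.
pose h (z : mR * mR) := (g z * (exponential_pdf r (z.2 - z.1))%:E * (exponential_pdf r z.1)%:E)%E.
have mh : measurable_fun setT h.
  apply: emeasurable_funM; first exact: emeasurable_funM.
  by apply: (measurableT_comp mpdf).
have h0 z : (0 <= h z)%E by rewrite !mule_ge0 // lee_fin.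
have mint : measurable_fun [set: mR]
    (fun x => \int[mu]_u (g (x, u) * (exponential_pdf r (u - x))%:E))%E.
  apply: (@measurable_fun_fubini_tonelli_F _ _ _ _ _ mu
    (fun z => g z * (exponential_pdf r (z.2 - z.1))%:E)%E).
    exact: emeasurable_funM.
  by move=> z; rewrite mule_ge0 // lee_fin.
rewrite (ge0_integral_exponential_law r0 epsE mint); last first.
  by move=> x; apply: integral_ge0 => u _; rewrite mule_ge0 // lee_fin.
transitivity (\int[mu]_x \int[mu]_u h (x, u))%E.
  apply: eq_integral => x _; rewrite -ge0_integralZr ?lee_fin //.
  - apply: emeasurable_funM.
      exact: (measurableT_comp mg (mpair x)).
    exact: (measurableT_comp msub (mpair x)).
  - by move=> u _; rewrite mule_ge0 // lee_fin.
rewrite fubini_tonelli //.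
apply: eq_integral => u _.
have [u0|u0] := ltP u 0.
  rewrite lt0_exponential_pdf // mulr0 mul0e integral0_eq // => x _.
  rewrite /h /=; have [x0|x0] := ltP x 0.
    by rewrite (lt0_exponential_pdf _ x0) mule0.
  by rewrite (@lt0_exponential_pdf _ _ (u - x)) ?mule0 ?mul0e //; lra.
rewrite [X in (_ * X)%E]integral_mkcond -ge0_integralZl //.
- apply: eq_integral => x _; rewrite patchE mem_setE in_itv /= /h /=.
  have [x0|x0] := ltP x 0; first by rewrite (lt0_exponential_pdf _ x0) !mule0.
  have [xu|xu] := leP x u; last first.
    by rewrite (@lt0_exponential_pdf _ _ (u - x)) ?mule0 ?mul0e //; lra.
  rewrite !exponential_pdfE ?subr_ge0 //.
  rewrite -muleA -EFinM muleC; congr (_%:E * _)%E.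
  rewrite mulrACA -expRD -mulrA; congr (_ * (_ * expR _)); ring.
- apply/measurable_restrict => //; apply: measurable_funTS.
  by apply: measurableT_comp => //; exact: measurable_fun_pair.
- by move=> x _; rewrite patchE; case: ifP.
- by rewrite lee_fin mulr_ge0 // ltW.
Qed.

End convolution.

(** * The sign of a linear combination of exponential variables *)

Section pos_prob.
Context {R : realType} (eps : probability (measurableTypeR R) R).
Local Notation mR := (measurableTypeR R).

(** The probability that s + c_1 D_1 + ... + c_m D_m > 0, for independent
    D_i of law eps, as an iterated integral.  Real-valued integrals are used
    because signed combinations of these probabilities occur below. *)
Fixpoint pos_prob (cs : seq R) (s : R) : R :=
  if cs is c :: cs' then \int[eps]_y pos_prob cs' (s + c * y) else (0 < s)%R%:R.

(** Integrating once more requires both measurability in s and the bounds, hence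
    the joint induction. *)
Lemma pos_prob_subproof cs :
  measurable_fun [set: mR] (pos_prob cs : mR -> R) /\ forall s, 0 <= pos_prob cs s <= 1.
Proof.
elim: cs => [|c cs [mp p01]] /=.
  split; last by move=> s; case: ltP; rewrite ?lexx ?ler01.
  exact: measurable_gt0.
have mz : measurable_fun [set: mR * mR] (fun z => (pos_prob cs (z.1 + c * z.2))%:E).
  apply/measurable_EFinP; apply: (measurableT_comp mp).
  by apply: measurable_funD => //; exact: measurable_funM.
have ms s : measurable_fun [set: mR] (fun y => (pos_prob cs (s + c * y))%:E).
  apply/measurable_EFinP; apply: (measurableT_comp mp).
  by apply: measurable_funD => //; exact: measurable_funM.
split.
  have mI : measurable_fun [set: mR]
      (fun s => \int[eps]_y (pos_prob cs (s + c * y)%R)%:E)%E.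
    apply: (@measurable_fun_fubini_tonelli_F _ _ mR mR R eps
      (fun z => (pos_prob cs (z.1 + c * z.2)%R)%:E)) => //.
    by move=> z; rewrite lee_fin; have /andP[] := p01 (z.1 + c * z.2).
  exact: (measurableT_comp (fine_measurable measurableT) mI).
move=> s; have p0 y : 0 <= pos_prob cs (s + c * y) by have /andP[] := p01 (s + c * y).
rewrite Rintegral_ge0 //=.
rewrite /Rintegral -[leRHS]/(fine 1%E) fine_le //.
  rewrite ge0_fin_numE; last by apply: integral_ge0 => y _; rewrite lee_fin.
  apply: (@le_lt_trans _ _ (\int[eps]_y (cst 1%E y))%E); last first.
    by rewrite integral_cst // mul1e; exact: (le_lt_trans (probability_le1 eps measurableT) (ltry _)).
  by apply: ge0_le_integral => //= y _; rewrite lee_fin //; have /andP[] := p01 (s + c * y).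
apply: (@le_trans _ _ (\int[eps]_y (cst 1%E y))%E); last first.
  by rewrite integral_cst // mul1e; exact: (probability_le1 eps measurableT).
by apply: ge0_le_integral => //= y _; rewrite lee_fin //; have /andP[] := p01 (s + c * y).
Qed.

Lemma measurable_pos_prob cs : measurable_fun [set: mR] (pos_prob cs : mR -> R).
Proof. by have [] := pos_prob_subproof cs. Qed.

Lemma pos_prob_ge0 cs s : 0 <= pos_prob cs s.
Proof. by have [_ /(_ s)/andP[]] := pos_prob_subproof cs. Qed.

Lemma pos_prob_le1 cs s : pos_prob cs s <= 1.
Proof. by have [_ /(_ s)/andP[]] := pos_prob_subproof cs. Qed.

Lemma measurable_pos_prob_affine cs s c :
  measurable_fun [set: mR] (fun y : mR => pos_prob cs (s + c * y)).
Proof.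
apply: (measurableT_comp (measurable_pos_prob cs)).
by apply: measurable_funD => //; exact: measurable_funM.
Qed.

Lemma integrable_pos_prob cs s c :
  eps.-integrable [set: mR] (EFin \o (fun y => pos_prob cs (s + c * y))).
Proof.
apply: measurable_bounded_integrable => //.
- exact: (le_lt_trans (probability_le1 eps measurableT) (ltry _)).
- exact: measurable_pos_prob_affine.
- exists 1; split => // M M1 y _ /=.
  by rewrite ger0_norm ?pos_prob_ge0 // (le_trans (pos_prob_le1 _ _)) // ltW.
Qed.

Lemma EFin_pos_prob c cs s :
  (pos_prob (c :: cs) s)%:E = (\int[eps]_y (pos_prob cs (s + c * y))%:E)%E.
Proof.
rewrite /= /Rintegral fineK //.
by have /integrable_fin_num := integrable_pos_prob cs s c; apply.
Qed.

End pos_prob.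

Section two_gaps.
Context {R : realType} (r : R) (eps : probability (measurableTypeR R) R).
Hypothesis r0 : 0 < r.
Hypothesis epsE : forall A, measurable A -> eps A = exponential_prob r A.
Notation mu := (@lebesgue_measure R).
Local Notation mR := (measurableTypeR R).

(** Multiplied by the slope, the length is the increment of the positive part of
    the affine function, also when the slope is zero. *)
Lemma mul_halfline_length (t c u : R) :
  c * halfline_length t c u = Num.max (t + c * u) 0 - Num.max t 0.
Proof.
rewrite /halfline_length; have [->|c0] := eqVneq c 0.
  by rewrite !mul0r addr0 subrr.
by rewrite mulrC divfK.
Qed.

Lemma halfline_length_ge0 (t c u : R) : 0 <= u -> 0 <= halfline_length t c u.
Proof. by move=> u0; rewrite -lee_fin -length_halfline. Qed.

Lemma measurable_halfline_length (s c d : R) :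
  measurable_fun [set: mR] (fun u : mR => halfline_length (s + d * u) c u).
Proof.
have mt : measurable_fun [set: mR] (fun u : mR => s + d * u).
  by apply: measurable_funD => //; exact: measurable_funM.
rewrite /halfline_length; case: eqP => _.
  apply: measurable_funM => //; exact: (measurableT_comp (@measurable_gt0 R) mt).
apply: measurable_funM; last exact: measurable_cst.
have mtc : measurable_fun [set: mR] (fun u : mR => s + d * u + c * u).
  by apply: measurable_funD => //; exact: measurable_funM.
have m0 : measurable_fun [set: mR] (fun u : mR => 0 : R) by exact: measurable_cst.
exact: (measurable_funB (measurable_maxr mtc m0) (measurable_maxr mt m0)).
Qed.

Let weight s c d u := r * exponential_pdf r u * halfline_length (s + d * u) c u.

Let weight_ge0 s c d u : 0 <= weight s c d u.
Proof.
rewrite /weight; have [u0|u0] := ltP u 0.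
  by rewrite lt0_exponential_pdf // mulr0 mul0r.
by rewrite !mulr_ge0 ?halfline_length_ge0 ?exponential_pdf_ge0 // ltW.
Qed.

(** Conditioning on the sum u of the two variables: the first one being uniform
    on [0, u], only the length of a half-line inside [0, u] remains. *)
Lemma pos_prob2E s c d :
  (pos_prob eps [:: c + d; d] s)%:E = (\int[mu]_u (weight s c d u)%:E)%E.
Proof.
transitivity (\int[eps]_x \int[eps]_y ((0 < s + c * x + d * (x + y))%R%:R)%:E)%E.
  rewrite EFin_pos_prob; apply: eq_integral => x _.
  rewrite EFin_pos_prob; apply: eq_integral => y _ /=.
  by congr ((0 < _)%R%:R)%:E; ring.
rewrite (@integral_exponential_convolution _ r eps r0 epsE
  (fun z => ((0 < s + c * z.1 + d * z.2)%R%:R)%:E)) /=; last 2 first.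
- apply/measurable_EFinP.
  have m3 : measurable_fun [set: mR * mR] (fun z : mR * mR => s + c * z.1 + d * z.2).
    by do ?apply: measurable_funD => //; exact: measurable_funM.
  exact: (measurableT_comp (@measurable_gt0 R) m3).
- by move=> z; rewrite lee_fin ler0n.
apply: eq_integral => u _; rewrite /weight.
have [u0|u0] := ltP u 0.
  by rewrite lt0_exponential_pdf // mulr0 mul0r mul0e.
rewrite [in RHS]EFinM; congr (_ * _)%E; rewrite -length_halfline //.
have mS : measurable [set x : mR | 0 < s + d * u + c * x].
  rewrite (_ : [set _ | _] = setT `&` (fun x : mR => s + d * u + c * x) @^-1` `]0, +oo[%classic).
    have : measurable_fun [set: mR] (fun x : mR => s + d * u + c * x).
      by apply: measurable_funD => //; exact: measurable_funM.
    by apply => //; exact: measurable_itv.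
  by rewrite setTI; apply/seteqP; split => x /=; rewrite in_itv /= andbT.
transitivity (\int[mu]_(x in `[0%R, u]) (\1_[set x : mR | (0 < s + d * u + c * x)%R] x)%:E)%E.
  by apply: eq_integral => x _; rewrite indicE mem_setE /= addrAC.
rewrite integral_indic //.
by congr (mu _); apply/seteqP; split => x /=; rewrite in_itv /=; case.
Qed.

Let integrable_weight s c d : mu.-integrable [set: mR] (EFin \o weight s c d).
Proof.
apply/integrableP; split.
  apply/measurable_EFinP; apply: measurable_funM.
    by apply: measurable_funM => //; exact: measurable_exponential_pdf.
  exact: measurable_halfline_length.
under eq_integral do rewrite /= ger0_norm //.
by rewrite -pos_prob2E ltry.
Qed.

Let pos_prob2R s c d :
  pos_prob eps [:: c + d; d] s = \int[mu]_u weight s c d u.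
Proof. by rewrite /Rintegral -pos_prob2E. Qed.

(** Given the sum u of two variables, the three conditional probabilities are,
    up to the factor u, lengths of sets where an affine function is positive.  Multiplied by the slopes c1 - c2,
    c1 and c2 they become
      (s + c1 u)^+ - (s + c2 u)^+,  (s + c1 u)^+ - s^+  and  (s + c2 u)^+ - s^+,
    and the first is the difference of the other two. *)
Lemma pos_prob2 c1 c2 s :
  (c1 - c2) * pos_prob eps [:: c1; c2] s =
  c1 * pos_prob eps [:: c1] s - c2 * pos_prob eps [:: c2] s.
Proof.
(* A zero coefficient brings the one-variable probabilities to the form of
   two-variable ones. *)
have pos_prob_0 c : pos_prob eps [:: c] s = pos_prob eps [:: c + 0; 0] s.
  apply: EFin_inj; rewrite !EFin_pos_prob addr0; apply: eq_integral => x _ /=.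
  congr EFin; under eq_Rintegral do rewrite mul0r addr0.
  rewrite Rintegral_cst // -[LHS]mulr1; congr (_ * _).
  by rewrite [X in fine X](_ : _ = 1%E) //; exact: (probability_setT eps).
have E2 : pos_prob eps [:: c1; c2] s = \int[mu]_u weight s (c1 - c2) c2 u.
  by rewrite -pos_prob2R subrK.
rewrite E2 !pos_prob_0 !pos_prob2R -!RintegralZl //.
rewrite -RintegralB //.
- apply: eq_Rintegral => u _; rewrite /weight.
  transitivity (r * exponential_pdf r u *
      ((c1 - c2) * halfline_length (s + c2 * u) (c1 - c2) u)); first by ring.
  transitivity (r * exponential_pdf r u *
      (c1 * halfline_length (s + 0 * u) c1 u - c2 * halfline_length (s + 0 * u) c2 u));
    last by ring.
  rewrite !mul_halfline_length mul0r addr0; congr (_ * _).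
  by rewrite opprD addrACA opprK addNr addr0; congr (Num.max _ _ - Num.max _ _); ring.
- exact: (integrableZl measurableT c1 (integrable_weight s c1 0)).
- exact: (integrableZl measurableT c2 (integrable_weight s c2 0)).
Qed.

End two_gaps.

(** * Divided differences *)

Section pos_prob_formula.
Context {R : realType} (r : R) (eps : probability (measurableTypeR R) R).
Hypothesis r0 : 0 < r.
Hypothesis epsE : forall A, measurable A -> eps A = exponential_prob r A.
Local Notation mR := (measurableTypeR R).
Local Notation p := (pos_prob eps).

(** The two coefficients stand in the innermost integrals, and the outer ones are
    linear. *)
Lemma pos_prob_cat2 cs c1 c2 s :
  (c1 - c2) * p (cs ++ [:: c1; c2]) s =
  c1 * p (cs ++ [:: c1]) s - c2 * p (cs ++ [:: c2]) s.
Proof.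
elim: cs s => [|c cs IH] s; first exact: (pos_prob2 r0 epsE).
have I cs' := integrable_pos_prob eps cs' s c.
rewrite !cat_cons /= -!RintegralZl // -RintegralB //.
- by apply: eq_Rintegral => y _; exact: IH.
- exact: (integrableZl measurableT c1 (I (cs ++ [:: c1]))).
- exact: (integrableZl measurableT c2 (I (cs ++ [:: c2]))).
Qed.

(** The law eps gives full mass to the positive numbers, which is the gap identity
    for k = 0, u = 0 and the constant function 1. *)
Lemma pos_prob1 c : p [:: c] 0 = (0 < c)%R%:R.
Proof.
have p1 : p [:: 1] 0 = 1.
  apply: EFin_inj; rewrite EFin_pos_prob /=.
  have := integral_exponential_gap r0 epsE (u := 0) 0 (lexx 0)
    (measurable_cst 1%E) (fun=> lee01).
  rewrite !mulr0 oppr0 expR0 divr1 mul1e integral_cst // mul1e.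
  rewrite [X in _ = X -> _](_ : _ = 1%E); last exact: (probability_setT eps).
  move=> <-; apply: eq_integral => x _.
  by rewrite /= mule1 add0r mul1r ?mulr0 mul0r oppr0 expR0 mulr1.
have [c0|c0] := ltP 0 c.
  rewrite -[RHS]p1; apply: eq_Rintegral => x _ /=.
  by rewrite !add0r mul1r pmulr_rgt0.
apply/eqP; rewrite eq_le pos_prob_ge0 andbT.
have I c' := integrable_pos_prob eps [::] 0 c'.
(* For c <= 0 the events 0 < c x and 0 < x are disjoint, and the second one is
   almost sure. *)
have : p [:: c] 0 + p [:: 1] 0 <= \int[eps]_x (cst 1) x.
  rewrite -[X in X <= _]RintegralD //; last 2 first.
  - exact: I.
  - exact: I.
  apply: le_Rintegral => //.
  - exact: (integrableD measurableT (I c) (I 1)).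
  - exact: finite_measure_integrable_cst.
  move=> x _ /=; rewrite !add0r mul1r.
  have [x0|x0] := ltP 0 x; last by rewrite addr0; case: ltP; rewrite ?ler01.
  rewrite ltNge (_ : c * x <= 0) /= ?add0r //; nra.
rewrite Rintegral_cst // p1 mul1r [X in fine X](_ : _ = 1%E) /=; last exact: (probability_setT eps).
lra.
Qed.

(** The divided difference of the function c^(m - 1) 1_(c > 0) at the m points
    of cs. *)
Definition halfline_divided_difference (cs : seq R) : R :=
  \sum_(c <- cs) (0 < c)%R%:R * \prod_(k <- cs | k != c) (c / (c - k)).
Local Notation dd := halfline_divided_difference.

(** Termwise partial fractions: for c distinct from a and b,
    (a - b) c^2 / ((c - a) (c - b)) = a c / (c - a) - b c / (c - b). *)
Lemma halfline_divided_difference_cat2 cs a b : uniq (cs ++ [:: a; b]) ->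
  (a - b) * dd (cs ++ [:: a; b]) = a * dd (cs ++ [:: a]) - b * dd (cs ++ [:: b]).
Proof.
rewrite cat_uniq /= !orbF negb_or !inE andbT => /and3P[_ /andP[acs bcs] ab].
have ba0 : b - a != 0 by rewrite subr_eq0 eq_sym.
have ab0 : a - b != 0 by rewrite subr_eq0.
rewrite /dd !big_cat /= !big_cons !big_nil !addr0 !mulrDr.
rewrite !big_cat /= !big_cons !big_nil !eqxx /= (eq_sym b a) ab /= !mulr1.
set S := \sum_(c <- cs) _; set Sa := \sum_(c <- cs) _; set Sb := \sum_(c <- cs) _.
have -> : (a - b) * S = a * Sa - b * Sb.
  rewrite !big_distrr /= -sumrB; apply: eq_big_seq => c ccs.
  have ca : c != a by apply: contraNneq acs => <-.
  have cb : c != b by apply: contraNneq bcs => <-.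
  rewrite !big_cat /= !big_cons !big_nil ![_ == c]eq_sym ca cb !mulr1.
  by field; rewrite !subr_eq0 ca cb.
set A := \prod_(_ <- cs | _) _; set B := \prod_(_ <- cs | _) _.
by field; rewrite ba0 ab0.
Qed.

(** Both sides obey the recursion that trades two coefficients for one, and they
    agree on one coefficient. *)
Lemma pos_prob_formula cs : uniq cs -> cs != [::] -> p cs 0 = dd cs.
Proof.
elim: {cs}(size cs) {-2}cs (leqnn (size cs)) => [|n IH] cs; first by case: cs.
case/lastP: cs => [//|cs b]; case/lastP: cs => [|cs a].
  move=> _ _ _; change (p [:: b] 0 = dd [:: b]).
  by rewrite pos_prob1 /dd big_seq1 big_cons eqxx big_nil /= mulr1.
rewrite -!cats1 -catA /= => sz u _.
have ab : a - b != 0.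
  by rewrite subr_eq0; move: u; rewrite cat_uniq /= inE andbT => /and3P[].
apply: (mulfI ab); rewrite pos_prob_cat2 halfline_divided_difference_cat2 //.
rewrite size_cat /= addn2 ltnS in sz.
rewrite !IH ?size_cat ?addn1 -?size_eq0 ?size_cat ?addn1 //.
- by apply: subseq_uniq u; rewrite cat_subseq ?sub1seq ?inE ?eqxx ?orbT //.
- by apply: subseq_uniq u; rewrite cat_subseq ?sub1seq ?inE ?eqxx ?orbT //.
Qed.

End pos_prob_formula.

(** * Independent samples *)

Section iid_sample.
Context {R : realType} d (T : measurableType d) (P : probability T R).
Variable eps : probability (measurableTypeR R) R.
Local Notation mR := (measurableTypeR R).

(** Independence and the common law eps in one product rule.  A subfamily is
    covered by taking A i to be the whole line outside of it. *)
Definition iid_sample (m : nat) (Y : 'I_m -> T -> mR) :=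
  (forall i, measurable_fun setT (Y i)) /\
  forall A : 'I_m -> set mR, (forall i, measurable (A i)) ->
    P [set w | forall i, A i (Y i w)] = (\prod_(i < m) eps (A i))%E.

Lemma iid_sample_tail m (Y : 'I_m.+1 -> T -> mR) :
  iid_sample Y -> iid_sample (fun i => Y (lift ord0 i)).
Proof.
move=> [mY indY]; split => [i|A mA]; first exact: mY.
pose A' j := if unlift ord0 j is Some i then A i else setT.
have -> : [set w | forall i, A i (Y (lift ord0 i) w)] = [set w | forall j, A' j (Y j w)].
  apply/seteqP; split => w /= Aw i; last by have := Aw (lift ord0 i); rewrite /A' liftK.
  by rewrite /A'; case: unliftP => // j ->; exact: Aw.
rewrite indY => [|j]; last by rewrite /A'; case: unlift.
rewrite big_ord_recl {1}/A' unlift_none probability_setT mul1e.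
by apply: eq_bigr => i _; rewrite /A' liftK.
Qed.

Lemma measurable_sample m (Y : 'I_m -> T -> mR) : (forall i, measurable_fun setT (Y i)) ->
  measurable_fun setT (fun w => [tuple Y i w | i < m]).
Proof.
move=> mY; apply/measurable_fun_tnthP => i.
by rewrite (_ : _ \o _ = Y i) //; apply/funext => w /=; rewrite tnth_mktuple.
Qed.

Definition rectangles m : set (set (m.-tuple mR)) :=
  [set B | exists2 A : 'I_m -> set mR, (forall i, measurable (A i)) &
     B = [set t | forall i, A i (tnth t i)]].

Lemma measurable_rectangles m : @measurable _ (m.-tuple mR) = <<s @rectangles m >>.
Proof.
apply/seteqP; split.
  apply: smallest_sub; first exact: smallest_sigma_algebra.
  move=> B; rewrite -bigcup_seq /= => -[i _ [A mA <-]].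
  apply: sub_sigma_algebra; exists (fun j => if j == i then A else setT) => [j|].
    by case: eqP.
  rewrite setTI; apply/seteqP; split => t /= At.
    by move=> j; case: eqP => // ->.
  by have := At i; rewrite eqxx.
apply: smallest_sub; first exact: sigma_algebra_measurable.
move=> B [A mA ->].
rewrite (_ : [set _ | _] = \bigcap_(i in [set: 'I_m]) ((@tnth _ mR ^~ i) @^-1` A i)).
  apply: fin_bigcap_measurable => // i _.
  rewrite -[X in measurable X]setTI; exact: measurable_tnth.
by apply/seteqP; split => t /= At i; [move=> _|]; exact: At.
Qed.

(** For fixed A both sides are finite measures of B, and they agree on the
    rectangles, a pi-system that generates the Borel sets of tuples. *)
Lemma iid_sample_head_tail_rectangle m (Y : 'I_m.+1 -> T -> mR) A B :
  iid_sample Y -> measurable A -> measurable B ->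
  P [set w | A (Y ord0 w) /\ B [tuple Y (lift ord0 i) w | i < m]] =
  (eps A * P [set w | B [tuple Y (lift ord0 i) w | i < m]])%E.
Proof.
move=> iidY mA mB; have [mY indY] := iidY; have [mY' indY'] := iid_sample_tail iidY.
have mt := measurable_sample mY'.
set t := fun w => _ in mt *.
have mD : measurable (Y ord0 @^-1` A) by rewrite -[X in measurable X]setTI; exact: mY.
(* B |-> P (head in A and tail in B), to be compared with eps A times the law of
   the tail. *)
pose m1 : {measure set (m.-tuple mR) -> \bar R} :=
  measure_function_pushforward__canonical__measure_function_Measure (mrestr P mD) mt.
have eA0 : 0 <= fine (eps A) by rewrite fine_ge0.
pose m2 : {measure set (m.-tuple mR) -> \bar R} := mscale (NngNum eA0)
  (measure_function_pushforward__canonical__measure_function_Measure P mt).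
have eAE : (fine (eps A))%:E = eps A by rewrite fineK // fin_num_measure.
transitivity (m1 B).
  by rewrite /m1 /= /pushforward /mrestr; congr (P _); apply/seteqP; split => w /= [].
transitivity (m2 B); last by rewrite /m2 /= /mscale /= eAE.
apply: (measure_unique (@rectangles m) (fun=> setT)) => //.
- exact: measurable_rectangles.
- move=> _ _ [A1 mA1 ->] [A2 mA2 ->]; exists (fun i => A1 i `&` A2 i) => [i|].
    exact: measurableI.
  apply/seteqP; split => z /=; first by move=> [h1 h2] i.
  by move=> h; split => i; have [] := h i.
- by move=> _; exists (fun=> setT) => //; apply/seteqP.
- by apply/seteqP; split => // z _; exists 0%N.
- move=> _ [A1 mA1 ->]; rewrite /m1 /m2 /= /mscale /= eAE /pushforward /mrestr.
  have -> : t @^-1` [set z | forall i, A1 i (tnth z i)] =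
      [set w | forall i, A1 i (Y (lift ord0 i) w)].
    by apply/seteqP; split => w /= h i; have := h i; rewrite tnth_mktuple.
  rewrite indY' //.
  pose A' j := if unlift ord0 j is Some i then A1 i else A.
  have -> : [set w | forall i, A1 i (Y (lift ord0 i) w)] `&` Y ord0 @^-1` A =
      [set w | forall j, A' j (Y j w)].
    apply/seteqP; split => w /=.
      by move=> [h h0] j; rewrite /A'; case: unliftP => [i|] ->.
    move=> h; split; last by have := h ord0; rewrite /A' unlift_none.
    by move=> i; have := h (lift ord0 i); rewrite /A' liftK.
  rewrite indY => [|j]; last by rewrite /A'; case: unlift.
  rewrite big_ord_recl {1}/A' unlift_none; congr (_ * _)%E.
  by apply: eq_bigr => i _; rewrite /A' liftK.
- move=> _; rewrite /m1 /= /pushforward /mrestr.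
  by rewrite (le_lt_trans (probability_le1 _ _)) ?ltry // setTI.
Qed.

(** The joint law of the head and the tail is a product, so the head can be
    integrated out separately. *)
Lemma iid_sample_head_tail m (Y : 'I_m.+1 -> T -> mR) (C : set (mR * m.-tuple mR)) :
  iid_sample Y -> measurable C ->
  P [set w | C (Y ord0 w, [tuple Y (lift ord0 i) w | i < m])] =
  (\int[eps]_x P [set w | C (x, [tuple Y (lift ord0 i) w | i < m])])%E.
Proof.
move=> iidY mC; have [mY _] := iidY; have [mY' _] := iid_sample_tail iidY.
have mt := measurable_sample mY'.
set t := fun w => _ in mt *.
have mYt : measurable_fun setT (fun w => (Y ord0 w, t w)) by exact: measurable_fun_pair.
pose nu : {measure set (mR * m.-tuple mR) -> \bar R} :=
  measure_function_pushforward__canonical__measure_function_Measure P mYt.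
pose Pt : probability (m.-tuple mR) R :=
  distribution P (HB.pack_for {mfun T >-> m.-tuple mR} t (isMeasurableFun.Build _ _ _ _ _ mt)).
transitivity (nu C) => //.
rewrite -(@product_measure_unique _ _ _ _ _ eps Pt nu) => [||//]; last first.
  by move=> A B mA mB; exact: iid_sample_head_tail_rectangle.
by apply: eq_integral => x _ /=; congr (P _); apply/seteqP; split => w /=;
  rewrite /xsection /= ?mem_setE ?inE.
Qed.

End iid_sample.

(** * Strictly increasing samples *)

Section increasing_samples.
Context {R : realType}.
Local Notation mR := (measurableTypeR R).

(** The condition u < v_1 < ... < v_m and s + a_1 v_1 + ... + a_m v_m > 0.  In
    this form, removing v_1 leaves a condition of the same kind, with lower end
    v_1 and starting value s + a_1 v_1.  The lists a and v are meant to have the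
    same length m. *)
Fixpoint increasing_pos (a : seq R) (u s : R) (v : seq R) : bool :=
  match a, v with
  | a0 :: a', v0 :: v' => (u < v0) && increasing_pos a' v0 (s + a0 * v0) v'
  | _, _ => 0 < s
  end.

Lemma increasing_pos_thead m (a0 : R) a u s (v : m.+1.-tuple R) :
  increasing_pos (a0 :: a) u s v =
  (u < thead v) && increasing_pos a (thead v) (s + a0 * thead v) (behead v).
Proof. by case/tupleP: v => x v; rewrite theadE. Qed.

Lemma mktuple_cons (K : Type) m (f : 'I_m.+1 -> K) :
  [tuple f i | i < m.+1] = f ord0 :: [tuple f (lift ord0 i) | i < m] :> seq K.
Proof. by rewrite /= enum_ordSl /= -map_comp. Qed.

(** Each entry is the mean of a tail of a.  By summation by parts these are the
    coefficients of a_1 v_1 + ... + a_m v_m with respect to the normalized gaps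
    (m - j + 1) (v_j - v_(j-1)), where v_0 = 0. *)
Fixpoint gap_coefs (a : seq R) : seq R :=
  if a is _ :: a' then (\sum_(x <- a) x) / (size a)%:R :: gap_coefs a' else [::].

Lemma measurable_increasing_pos d (Z : measurableType d) m (a : seq R)
  (u s : Z -> mR) (v : Z -> m.-tuple mR) : size a = m ->
  measurable_fun setT u -> measurable_fun setT s -> measurable_fun setT v ->
  measurable [set z | increasing_pos a (u z) (s z) (v z)].
Proof.
elim: m a u s v => [|m IH] [|a0 a] //= u s v.
  move=> _ _ ms _; rewrite (_ : [set _ | _] = s @^-1` `]0, +oo[%classic).
    by rewrite -[X in measurable X]setTI; apply: ms => //; exact: measurable_itv.
  by apply/seteqP; split => z /=; rewrite in_itv /= andbT; case: (tval (v z)).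
move=> [sz] mu ms mv.
have mh : measurable_fun setT (fun z => thead (v z) : mR).
  exact: (measurableT_comp (measurable_tnth ord0) mv).
have mb : measurable_fun setT (fun z => [tuple of behead (v z)]).
  exact: (measurableT_comp (@measurable_behead _ mR m) mv).
have ms' : measurable_fun setT (fun z => s z + a0 * thead (v z) : mR).
  by apply: measurable_funD => //; exact: measurable_funM.
have -> : [set z | increasing_pos (a0 :: a) (u z) (s z) (v z)] =
    (fun z => thead (v z) - u z : mR) @^-1` `]0, +oo[%classic `&`
    [set z | increasing_pos a (thead (v z)) (s z + a0 * thead (v z)) [tuple of behead (v z)]].
  apply/seteqP; split => z; rewrite /mkset increasing_pos_thead /= in_itv /= andbT subr_gt0.
    by move=> /andP[].
  by move=> [-> ->].
apply: measurableI; last exact: IH.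
have md : measurable_fun setT (fun z => thead (v z) - u z : mR) by exact: measurable_funB.
by rewrite -[X in measurable X]setTI; apply: md => //; exact: measurable_itv.
Qed.

Context (r : R) (eps : probability mR R).
Hypothesis r0 : 0 < r.
Hypothesis epsE : forall A, measurable A -> eps A = exponential_prob r A.
Context d (T : measurableType d) (P : probability T R).

(** The normalized gaps of an exponential sample are independent and exponential.
    The three factors are the probability that all entries exceed u, the
    probability 1 / m! of the given ordering, and the probability of the sign
    condition expressed through the gaps above u.  The induction integrates out
    the smallest entry, which becomes the lower end for the others. *)
Lemma probability_increasing_pos m (a : seq R) (u s : R) (Y : 'I_m -> T -> mR) :
  size a = m -> iid_sample P eps Y -> 0 <= u ->
  P [set w | increasing_pos a u s [tuple Y i w | i < m]] =
  (expR (- (r * m%:R * u)) / m`!%:R *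
   pos_prob eps (gap_coefs a) (s + (\sum_(x <- a) x) * u))%:E.
Proof.
elim: m a u s Y => [|m IH] [|a0 a] // u s Y.
  move=> _ _ _; rewrite big_nil mul0r addr0 mulr0 mul0r oppr0 expR0 fact0 divr1 mul1r /=.
  have [s0|s0] := ltP 0 s.
    by rewrite (_ : [set _ | _] = setT) ?probability_setT //; apply/seteqP.
  by rewrite (_ : [set _ | _] = set0) ?measure0 //; apply/seteqP; split => w //=.
move=> [sz] iidY u0; have iidY' := iid_sample_tail iidY.
pose C : set (mR * m.-tuple mR) :=
  [set z : mR * m.-tuple mR | increasing_pos (a0 :: a) u s (z.1 :: z.2)].
have mC : measurable C.
  have := @measurable_increasing_pos _ (mR * m.-tuple mR)%type m.+1 (a0 :: a)
    (fun=> u) (fun=> s) (fun z => [tuple of z.1 :: z.2]).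
  apply => //; first by rewrite /= sz.
  exact: measurable_cons.
have -> : [set w | increasing_pos (a0 :: a) u s [tuple Y i w | i < m.+1]] =
    [set w | C (Y ord0 w, [tuple Y (lift ord0 i) w | i < m])].
  by apply/funext => w; rewrite /C /mkset mktuple_cons.
rewrite (iid_sample_head_tail iidY mC).
set c := pos_prob eps (gap_coefs a).
set A := \sum_(x <- a) x.
pose G (x : mR) : \bar R := (m`!%:R^-1 * c (s + (a0 + A) * x))%:E.
transitivity (\int[eps]_x (((u < x)%R%:R * expR (- (r * m%:R * x)))%:E * G x))%E.
  apply: eq_integral => x _; rewrite /C /=.
  have [ux|ux] := ltP u x; last first.
    by rewrite mul0r mul0e (_ : [set _ | _] = set0) ?measure0 //; apply/seteqP; split => w //=.
  rewrite mul1r /= (IH a x (s + a0 * x) _ sz iidY' (le_trans u0 (ltW ux))).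
  by rewrite /G -EFinM mulrA -/A -/c mulrDl addrA.
have mG : measurable_fun setT G.
  apply/measurable_EFinP; apply: measurable_funM => //.
  exact: measurable_pos_prob_affine.
have G0 x : (0 <= G x)%E by rewrite lee_fin mulr_ge0 ?invr_ge0 ?ler0n ?pos_prob_ge0.
rewrite (integral_exponential_gap r0 epsE) //.
rewrite [in RHS]/= big_cons -/A -/c sz.
have -> : (\int[eps]_y G (u + m.+1%:R^-1 * y)%R =
    (m`!%:R^-1)%:E * (pos_prob eps ((a0 + A) / m.+1%:R :: gap_coefs a) (s + (a0 + A) * u))%:E)%E.
  rewrite EFin_pos_prob -ge0_integralZl //.
  - apply: eq_integral => y _; rewrite /G EFinM; congr (_ * (c _)%:E)%E.
    by rewrite mulrDr mulrA addrA.
  - by apply/measurable_EFinP; exact: measurable_pos_prob_affine.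
  - by move=> y _; rewrite lee_fin pos_prob_ge0.
rewrite -!EFinM /= -/c factS natrM invfM; congr EFin; ring.
Qed.

End increasing_samples.

(** * Finite partitions and measurability of quotients *)

Section partition.
Context {R : realType} d (T : measurableType d) (P : probability T R).

Lemma probability_bigcup_seq (I : eqType) (s : seq I) (F : I -> set T) :
  uniq s -> (forall i, measurable (F i)) ->
  (forall i j w, F i w -> F j w -> i = j) ->
  measurable [set w | exists2 i, i \in s & F i w] /\
  P [set w | exists2 i, i \in s & F i w] = (\sum_(i <- s) P (F i))%E.
Proof.
move=> + mF tF; elim: s => [_|i s IH /= /andP[i_s us]].
  rewrite (_ : [set _ | _] = set0) ?measure0 ?big_nil //.
  by apply/seteqP; split => w //= [].
have [mU PU] := IH us.
rewrite (_ : [set w | exists2 j, j \in i :: s & F j w] =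
    F i `|` [set w | exists2 j, j \in s & F j w]); last first.
  apply/seteqP; split => w /=.
    by move=> [j]; rewrite inE => /predU1P[->|js] Fj; [left|right; exists j].
  by move=> [Fi|[j js Fj]]; [exists i|exists j] => //; rewrite inE ?eqxx ?js ?orbT.
split; first exact: measurableU.
rewrite measureU //; last first.
  apply/seteqP; split => w //= -[Fi [j js Fj]].
  by move: i_s; rewrite (tF _ _ _ Fi Fj) js.
by rewrite big_cons; congr (_ + _)%E; exact: PU.
Qed.

(** The sets F i cover everything up to a null set. *)
Lemma probability_partition (I : finType) (F : I -> set T) (M : set T) :
  (forall i, measurable (F i)) -> (forall i j w, F i w -> F j w -> i = j) ->
  (\sum_i P (F i) = 1)%E -> measurable M ->
  P M = (\sum_i P (F i `&` M))%E.
Proof.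
move=> mF tF F1 mM.
have [mU PU] := probability_bigcup_seq (enum_uniq I) mF tF.
set U := [set w | _] in mU PU.
rewrite big_enum F1 in PU.
have mFM i : measurable (F i `&` M) by exact: measurableI.
have tFM i j w : (F i `&` M) w -> (F j `&` M) w -> i = j by move=> [Fi _] [Fj _]; exact: tF Fi Fj.
have [mUM PUM] := probability_bigcup_seq (enum_uniq I) mFM tFM.
rewrite big_enum in PUM; rewrite -PUM.
have -> : [set w | exists2 i, i \in enum I & (F i `&` M) w] = U `&` M.
  apply/seteqP; split => w /=; first by move=> [i iI [Fi Mw]]; split => //; exists i.
  by move=> [[i iI Fi] Mw]; exists i.
have UC : P (~` U) = 0%E.
  transitivity (1 - P U)%E; first exact: probability_setC.
  by rewrite [X in (1 - X)%E](_ : _ = 1%E) ?subee.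
have U0 : P (M `\` U) = 0%E.
  apply/eqP; rewrite eq_le measure_ge0 andbT -UC.
  apply: le_measure; [apply/mem_set; exact: measurableD|apply/mem_set; exact: measurableC|].
  by move=> w [].
rewrite -[LHS](_ : P ((U `&` M) `|` (M `\` U)) = _); last first.
  congr (P _); apply/seteqP; split => w /=; first by case=> [[]|[]].
  by move=> Mw; have [Uw|Uw] := pselect (U w); [left|right].
rewrite measureU //; last first.
- by apply/seteqP; split => w //= [[Uw _] [_]].
- exact: measurableD.
- exact: measurableI.
by rewrite [X in (_ + X)%E](_ : _ = 0%E) ?adde0.
Qed.

(** Multiplying out by g w depends on its sign, and a zero denominator gives the
    quotient 0. *)
Lemma measurable_div_le (f g : T -> measurableTypeR R) (x : R) :
  measurable_fun setT f -> measurable_fun setT g ->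
  measurable [set w | f w / g w <= x].
Proof.
move=> mf mg.
have mh : measurable_fun setT (fun w => f w - x * g w : measurableTypeR R).
  by apply: measurable_funB => //; exact: measurable_funM.
have pre (h : T -> measurableTypeR R) (i : interval R) : measurable_fun setT h ->
    measurable (h @^-1` [set` i]).
  by move=> mh'; rewrite -[X in measurable X]setTI; apply: mh' => //; exact: measurable_itv.
rewrite (_ : [set _ | _] =
    (g @^-1` `]0, +oo[ `&` (fun w => f w - x * g w) @^-1` `]-oo, 0])
    `|` (g @^-1` `]-oo, 0[ `&` (fun w => f w - x * g w) @^-1` `[0, +oo[)
    `|` (g @^-1` `[0, 0] `&` [set w | 0 <= x])).
  apply: measurableU; [apply: measurableU; apply: measurableI|apply: measurableI].
  - exact: pre.
  - exact: pre.
  - exact: pre.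
  - exact: pre.
  - exact: pre.
  - have [x0|x0] := leP 0 x.
      by rewrite (_ : [set _ | _] = setT) //; apply/seteqP.
    by rewrite (_ : [set _ | _] = set0) //; apply/seteqP; split => w //=.
apply/seteqP; split => w /=; rewrite !in_itv /= ?andbT -?eq_le.
  have [g0|g0|g0] := ltgtP (g w) 0.
  - by rewrite ler_ndivrMr // => h; left; right; split => //; rewrite subr_ge0.
  - by rewrite ler_pdivrMr // => h; left; left; split => //; rewrite subr_le0.
  - by rewrite g0 invr0 mulr0 => h; right; split => //; rewrite lexx.
move=> [[[g0]|[g0]]|[/eqP <-]].
- by rewrite ler_pdivrMr // subr_le0.
- by rewrite ler_ndivrMr // subr_ge0.
- by rewrite invr0 mulr0.
Qed.

End partition.

(** * The statistic on a sorted sample *)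

Section sorted_statistic.
Context {R : realType}.

Lemma increasing_posE (a v : seq R) (u s : R) : size a = size v ->
  increasing_pos a u s v = path <%R u v && (0 < s + \sum_(p <- zip a v) p.1 * p.2).
Proof.
elim: a v u s => [|a0 a IH] [|v0 v] //= u s; first by rewrite big_nil addr0.
by move=> [sz]; rewrite IH // big_cons addrA andbA.
Qed.

(** The coefficient of the order statistic of rank k in n (K - x mean). *)
Definition K_weight (n : nat) (x : R) (k : nat) : R :=
  (3 * n%:R / 2 - 2 * k%:R + 1) / n%:R - x.

(** The weights of the ranks j, ..., n have mean e_(j,n) - x.  This is where the
    numbers e_(j,n) come from. *)
Lemma gap_coefs_K_weight (n j m : nat) (x : R) : (0 < n)%N -> (j + m = n.+1)%N ->
  \sum_(y <- [seq K_weight n x k | k <- iota j m]) y = m%:R * (e_coef R n j - x) /\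
  gap_coefs [seq K_weight n x k | k <- iota j m] =
  [seq e_coef R n k - x | k <- iota j m].
Proof.
move=> n0; elim: m j => [|m IH] j jm; first by rewrite big_nil mul0r.
have [S C] := IH j.+1 (etrans (addSnnS j m) jm).
have sumE : \sum_(y <- [seq K_weight n x k | k <- iota j m.+1]) y =
    m.+1%:R * (e_coef R n j - x).
  rewrite /= big_cons S /K_weight /e_coef.
  have nE : n%:R = j%:R + m%:R :> R by move: jm; rewrite addnS -natrD => -[->].
  have n1 : j%:R + m%:R != 0 :> R by rewrite -nE pnatr_eq0 -lt0n.
  rewrite nE -!natr1; field; exact: n1.
split => //.
rewrite -[gap_coefs _]/(_ / (size _)%:R :: gap_coefs _) sumE C /= size_map size_iota.
by rewrite mulrAC divff ?mul1r // pnatr_eq0.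
Qed.

Definition K_star_sorted (n : nat) (v : seq R) : R :=
  ((n%:R ^+ 2)^-1 * \sum_(1 <= k < n.+1) nth 0 v k.-1 * (3 * n%:R / 2 - 2 * k%:R + 1)) /
  (n%:R^-1 * \sum_(y <- v) y).

Lemma HP_Kstar_sorted n (f : 'I_n -> R) (v : seq R) :
  perm_eq v [seq f i | i <- enum 'I_n] -> sorted <=%R v ->
  HP_Kstar f = K_star_sorted n v.
Proof.
move=> vf sv; rewrite /HP_Kstar /HP_K /sample_mean /K_star_sorted /order_stat.
have -> : sort <=%R [seq f i | i <- enum 'I_n] = v.
  apply: (sorted_eq le_trans le_anti) => //; first exact: sort_le_sorted.
  by rewrite perm_sort perm_sym.
by rewrite (perm_big _ vf) /= big_map big_enum.
Qed.

Lemma K_star_sorted_le n (x : R) (v : seq R) : (0 < n)%N -> size v = n ->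
  path <%R 0 v ->
  (K_star_sorted n v <= x) =
  ~~ (0 < \sum_(p <- zip [seq K_weight n x k | k <- iota 1 n] v) p.1 * p.2).
Proof.
move=> n0 sv pv; rewrite -leNgt.
have nR : 0 < n%:R :> R by rewrite ltr0n.
have v0 : 0 < \sum_(y <- v) y.
  case: v sv pv => [sv|y v _ /(order_path_min lt_trans) /= /andP[y0 /allP v0]].
    by move: n0; rewrite -sv.
  rewrite big_cons ltr_pwDl // big_seq sumr_ge0 // => z zv; exact/ltW/v0.
have sumE : \sum_(p <- zip [seq K_weight n x k | k <- iota 1 n] v) p.1 * p.2 =
  n%:R^-1 * (\sum_(1 <= k < n.+1) nth 0 v k.-1 * (3 * n%:R / 2 - 2 * k%:R + 1)) -
  x * \sum_(y <- v) y.
  rewrite (big_nth (0, 0)) size_zip size_map size_iota sv minnn.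
  rewrite (big_nth (0 : R)) sv big_add1 /= !mulr_sumr -sumrB.
  apply: eq_big_nat => i /andP[_ i_n].
  rewrite nth_zip ?size_map ?size_iota //= (nth_map 0%N) ?size_iota // nth_iota // add1n.
  rewrite /K_weight; ring.
rewrite sumE /K_star_sorted; set N := \sum_(_ <= _ < _) _; set M := \sum_(_ <- _) _ in v0 *.
have -> : (n%:R ^+ 2)^-1 * N / (n%:R^-1 * M) = n%:R^-1 * N / M.
  by field; rewrite !gt_eqF.
by rewrite ler_pdivrMr // subr_le0.
Qed.

Lemma exists_sorting_perm n (f : 'I_n -> R) :
  exists s : 'S_n, sorted <=%R [seq f (s i) | i <- enum 'I_n].
Proof.
have : perm_eq (sort <=%R [tuple f i | i < n]) [tuple f i | i < n] by rewrite perm_sort.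
move=> /tuple_permP[s E]; exists s.
rewrite (_ : [seq _ | i <- _] = sort <=%R [tuple f i | i < n]); first exact: sort_le_sorted.
by rewrite E /=; apply: eq_map => i; rewrite tnth_mktuple.
Qed.

Lemma perm_eq_map_perm n (f : 'I_n -> R) (s : 'S_n) :
  perm_eq [seq f (s i) | i <- enum 'I_n] [seq f i | i <- enum 'I_n].
Proof.
rewrite (map_comp f s); apply: perm_map; apply: uniq_perm.
- by rewrite map_inj_uniq ?enum_uniq //; exact: perm_inj.
- exact: enum_uniq.
- move=> i; rewrite mem_enum inE; apply/mapP; exists ((s^-1)%g i); first by rewrite mem_enum.
  by rewrite permKV.
Qed.

(** Two sorted arrangements of the same values coincide, and a strictly
    increasing one has no repeated value. *)
Lemma strict_sorting_perm_inj n (f : 'I_n -> R) (s t : 'S_n) :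
  sorted <%R [seq f (s i) | i <- enum 'I_n] ->
  sorted <%R [seq f (t i) | i <- enum 'I_n] -> s = t.
Proof.
rewrite !lt_sorted_uniq_le => /andP[us ss] /andP[_ st].
have E : [seq f (s i) | i <- enum 'I_n] = [seq f (t i) | i <- enum 'I_n].
  apply: (sorted_eq le_trans le_anti) => //.
  by rewrite (perm_trans (perm_eq_map_perm f s)) // perm_sym perm_eq_map_perm.
have fs_inj : injective (fun i => f (s i)).
  apply/injectiveP; rewrite /injectiveb /dinjectiveb.
  by move: us; rewrite /image_mem enumT.
apply/permP => i; apply: (@perm_inj _ (s^-1)%g); rewrite permK; apply: fs_inj.
by rewrite permKV; have /eq_in_map := E; apply; rewrite mem_enum.
Qed.

End sorted_statistic.

(** * The law of the statistic *)

(** With zero coefficients and starting value 1 the sign condition is void, so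
    that the general formula also gives the probability of an ordering. *)
Lemma increasing_pos_zero (R : realType) n (u : R) (v : seq R) : size v = n ->
  increasing_pos (nseq n 0) u 1 v = path <%R u v.
Proof.
elim: n u v => [|n IH] u [|y v] //=; first by rewrite ltr01.
by move=> [sz]; rewrite mul0r addr0 IH.
Qed.

Section exponential_sample.
Context {R : realType} (r : R) (eps : probability (measurableTypeR R) R).
Hypothesis r0 : 0 < r.
Hypothesis epsE : forall A, measurable A -> eps A = exponential_prob r A.
Context d (T : measurableType d) (P : probability T R).
Local Notation mR := (measurableTypeR R).

Lemma iid_sample_perm n (Y : 'I_n -> T -> mR) (s : 'S_n) :
  iid_sample P eps Y -> iid_sample P eps (fun i => Y (s i)).
Proof.
move=> [mY indY]; split => [i|A mA]; first exact: mY.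
rewrite (_ : [set _ | _] = [set w | forall j, A ((s^-1)%g j) (Y j w)]); last first.
  apply/seteqP; split => w /= Aw i; first by have := Aw ((s^-1)%g i); rewrite permKV.
  by have := Aw (s i); rewrite permK.
apply: etrans; first by apply: (indY (fun j => A ((s^-1)%g j))) => j.
rewrite [LHS](reindex_inj (@perm_inj _ s)).
by apply: eq_bigr => i _; rewrite permK.
Qed.

Lemma measurable_sorted n (Y : 'I_n -> T -> mR) (s : seq 'I_n) :
  (forall i, measurable_fun setT (Y i)) ->
  measurable [set w | sorted <=%R [seq (Y i w : R) | i <- s]].
Proof.
have mtrue : measurable [set w : T | true].
  by rewrite (_ : [set _ | _] = setT) //; apply/seteqP; split => w.
move=> mY; case: s => [|i s] /=; first exact: mtrue.
elim: s i => [|j s IH] i /=; first exact: mtrue.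
rewrite (_ : [set _ | _] = (fun w => Y j w - Y i w : mR) @^-1` `[0, +oo[%classic `&`
    [set w | path <=%R (Y j w : R) [seq (Y i w : R) | i <- s]]).
  apply: measurableI => //.
  have mB : measurable_fun setT (fun w => Y j w - Y i w : mR).
    exact: (measurable_funB (mY j) (mY i)).
  by rewrite -[X in measurable X]setTI; apply: mB => //; exact: measurable_itv.
by apply/seteqP; split => w /=; rewrite in_itv /= andbT subr_ge0 => /andP.
Qed.

Lemma measurable_K_star_sorted n (Y : 'I_n -> T -> mR) (s : seq 'I_n) (x : R) :
  (forall i, measurable_fun setT (Y i)) ->
  measurable [set w | K_star_sorted n [seq (Y i w : R) | i <- s] <= x].
Proof.
move=> mY; apply: measurable_div_le; apply: measurable_funM => //.
  apply: measurable_sum => k; apply: measurable_funM => //.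
  have [ks|ks] := ltnP k.-1 (size s); last first.
    under eq_fun do rewrite nth_default ?size_map //.
    exact: measurable_cst.
  case: s ks => // i s ks.
  by under eq_fun do rewrite (nth_map i) //; exact: mY.
under eq_fun do rewrite big_map.
by apply: measurable_sum => i; exact: mY.
Qed.

(** On the set where a given permutation sorts the sample, the statistic is a
    quotient of two linear forms; finitely many such sets cover everything. *)
Lemma measurable_HP_Kstar n (Y : 'I_n -> T -> mR) (x : R) :
  (forall i, measurable_fun setT (Y i)) ->
  measurable [set w | HP_Kstar (fun i => Y i w : R) <= x].
Proof.
move=> mY.
rewrite (_ : [set _ | _] = \bigcup_(s in [set: 'S_n])
   ([set w | sorted <=%R [seq (Y (s i) w : R) | i <- enum 'I_n]] `&`
    [set w | K_star_sorted n [seq (Y (s i) w : R) | i <- enum 'I_n] <= x])).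
  apply: fin_bigcup_measurable => [|s _]; [exact: finite_finset|apply: measurableI].
    exact: (@measurable_sorted _ (fun i => Y (s i))).
  exact: (@measurable_K_star_sorted _ (fun i => Y (s i))).
apply/seteqP; split => w /=.
  have [s ss] := exists_sorting_perm (fun i => Y i w : R).
  by rewrite (HP_Kstar_sorted (perm_eq_map_perm _ s) ss) => h; exists s.
move=> [s _ [ss]].
by rewrite (HP_Kstar_sorted (perm_eq_map_perm (fun i => Y i w : R) s) ss).
Qed.

Lemma pos_prob_zero n : pos_prob eps (nseq n 0) 1 = 1.
Proof.
elim: n => [|n IH] /=; first by rewrite ltr01.
under eq_Rintegral do rewrite mul0r addr0 IH.
by rewrite Rintegral_cst // mul1r [X in fine X](_ : _ = 1%E) //; exact: (probability_setT eps).
Qed.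

Lemma gap_coefs_zero n : gap_coefs (nseq n 0) = nseq n 0 :> seq R.
Proof.
elim: n => //= n ->; rewrite big_cons big_nseq add0r.
by rewrite iter_addr_0 mul0rn mul0r.
Qed.

(** The events that a given permutation arranges the sample in strictly increasing
    positive order are disjoint and have probability 1 / n! each, so they have
    total probability 1.  On each of them K* > x is a sign condition whose
    probability is 1 / n! times the right-hand side. *)
Lemma probability_HP_Kstar_gt n (Y : 'I_n -> T -> mR) (x : R) : (0 < n)%N ->
  iid_sample P eps Y ->
  P (~` [set w | HP_Kstar (fun i => Y i w : R) <= x]) =
  (pos_prob eps [seq e_coef R n k - x | k <- iota 1 n] 0)%:E.
Proof.
move=> n0 iidY; have mM := measurableC (measurable_HP_Kstar x iidY.1).
have iidYs s := iid_sample_perm s iidY.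
pose V (s : 'S_n) w := [tuple Y (s i) w | i < n].
pose F (s : 'S_n) := [set w | increasing_pos (nseq n 0) 0 1 (V s w)].
have VE s w : V s w = [seq (Y (s i) w : R) | i <- enum 'I_n] :> seq R by [].
have FE s w : F s w = path <%R 0 [seq (Y (s i) w : R) | i <- enum 'I_n] :> Prop.
  by rewrite /F /mkset increasing_pos_zero // size_tuple.
have mF s : measurable (F s).
  apply: (measurable_increasing_pos (u := fun=> 0) (s := fun=> 1) (v := V s)) => //.
    by rewrite size_nseq.
  by apply: measurable_sample => i; exact: (iidYs s).1.
have tF s t w : F s w -> F t w -> s = t.
  rewrite !FE => /path_sorted ps /path_sorted pt.
  exact: (@strict_sorting_perm_inj _ _ (fun i => Y i w : R) s t ps pt).
have cst (c : R) : (\sum_(s : 'S_n) (c / n`!%:R)%:E = c%:E)%E.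
  rewrite sumEFin sumr_const card_Sn; congr EFin.
  by rewrite -[LHS]mulr_natr divfK.
(* Zero coefficients with starting value 1 give the probability of the cell
   itself. *)
rewrite (probability_partition mF tF _ mM); last first.
  rewrite -(cst 1); apply: eq_bigr => s _.
  rewrite (probability_increasing_pos r0 epsE 1 (size_nseq n 0) (iidYs s) (lexx 0)).
  by rewrite !mulr0 oppr0 expR0 addr0 gap_coefs_zero pos_prob_zero mulr1.
rewrite -(cst (pos_prob _ _ _)); apply: eq_bigr => s _.
have [sumE coefE] := @gap_coefs_K_weight R n 1 n x n0 (add1n n).
set a := [seq K_weight n x k | k <- iota 1 n] in sumE coefE.
have sza : size a = n by rewrite size_map size_iota.
have leE w : path <%R 0 [seq (Y (s i) w : R) | i <- enum 'I_n] ->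
    (HP_Kstar (fun i => Y i w : R) <= x) =
    ~~ (0 < \sum_(p <- zip a [seq (Y (s i) w : R) | i <- enum 'I_n]) p.1 * p.2).
  move=> pv; rewrite -K_star_sorted_le // -?VE ?size_tuple // VE.
  rewrite (HP_Kstar_sorted (perm_eq_map_perm (fun i => Y i w : R) s)) //.
  by apply: sub_sorted (path_sorted pv); exact: ltW.
have incE w : increasing_pos a 0 0 (V s w) =
    path <%R 0 [seq (Y (s i) w : R) | i <- enum 'I_n] &&
    (0 < \sum_(p <- zip a [seq (Y (s i) w : R) | i <- enum 'I_n]) p.1 * p.2).
  by rewrite increasing_posE ?size_tuple // VE add0r.
rewrite (_ : _ `&` _ = [set w | increasing_pos a 0 0 (V s w)]); last first.
  apply/seteqP; split => w; rewrite /mkset /setI /setC /mkset incE FE.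
    by move=> [pv]; rewrite leE // pv => /negP; rewrite negbK.
  by move=> /andP[pv S0]; split => //; rewrite leE // S0.
rewrite (probability_increasing_pos r0 epsE 0 sza (iidYs s) (lexx 0)).
by rewrite !mulr0 oppr0 expR0 addr0 coefE mul1r mulrC.
Qed.

End exponential_sample.

Theorem theorem2 (R : realType) (d d0 : measure_display)
  (T : measurableType d) (T0 : measurableType d0)
  (P : probability T R) (Q : probability T0 R)
  (n : nat) (n_ge1 : (1 <= n)%N)
  (X0 : {RV Q >-> R})
  (X0_cdf : forall x : R, 0 < x -> cdf X0 x = (1 - expR (- (x / 2)))%:E)
  (X : 'I_n -> {RV P >-> R})
  (X_sample : random_sample X X0)
  (e_neq : forall i k : nat, (1 <= i <= n)%N -> (1 <= k <= n)%N ->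
    i <> k -> e_coef R n i <> e_coef R n k)
  (x : R) :
  P [set w | HP_Kstar (fun i => X i w) <= x] =
  (1 - \sum_(1 <= i < n.+1)
         (\prod_(1 <= k < n.+1 | k != i)
            ((e_coef R n i - x) / (e_coef R n i - e_coef R n k)))
         * I_lt x (e_coef R n i))%:E.
Proof.
have r0 : (0 : R) < 2^-1 by rewrite invr_gt0.
pose eps : probability (measurableTypeR R) R :=
  exponential_distribution_exponential_prob__canonical__probability_measure_Probability r0.
have epsE A : measurable A -> eps A = exponential_prob 2^-1 A by [].
have lawE (i : 'I_n) (A : set R) : measurable A -> P (X i @^-1` A) = eps A.
  move=> mA; apply: etrans (X_sample.2 i A mA) _.
  apply: (@cdf_exponential_law R 2^-1 (distribution Q X0)) => // y y0.
  by rewrite mulrC; exact: X0_cdf.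
have iidX : iid_sample P eps (fun i => X i : T -> measurableTypeR R).
  split => [i|A mA].
    exact: (measurable_funP (X i)).
  have := X_sample.1 [set: 'I_n]%SET A mA.
  rewrite (_ : \bigcap_(i in _) _ = [set w | forall i, A i (X i w)]); last first.
    by apply/seteqP; split => w /= Aw i; [apply: Aw; rewrite /= inE|move=> _; exact: Aw].
  move=> ->; apply: eq_big => [i|i _]; first by rewrite inE.
  exact: (lawE i _ (mA i)).
have mK := measurable_HP_Kstar x iidX.1.
rewrite -[X in P X]setCK probability_setC; last exact: measurableC.
rewrite EFinB; congr (_ - _)%E.
rewrite (probability_HP_Kstar_gt r0 epsE x n_ge1 iidX); congr EFin.
have e_inj : {in iota 1 n &, injective (fun k => e_coef R n k - x)}.
  move=> i k; rewrite !mem_iota add1n !ltnS => ir kr /addIr eE.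
  by apply/eqP; apply: contra_eqT eE => /eqP ik; apply/eqP; exact: e_neq.
rewrite (pos_prob_formula r0 epsE); last 2 first.
- by rewrite map_inj_in_uniq ?iota_uniq.
- by case: n n_ge1 {e_neq X X_sample lawE iidX mK e_inj}.
rewrite /halfline_divided_difference big_map /index_iota subn1 /=.
apply: eq_big_seq => i iI; rewrite mulrC; congr (_ * _); last first.
  by rewrite /I_lt subr_gt0; case: ifP.
rewrite big_map [LHS]big_seq_cond [RHS]big_seq_cond; apply: eq_big => k.
  case: (boolP (k \in _)) => //= kI; congr negb; apply/eqP/eqP => [/e_inj|-> //].
  exact.
by rewrite opprB addrA subrK.
Qed.
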